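(* As formal power series in $q$, $$\frac{f(q^5,q^3)}{\varphi(q^2)}=\frac{f(q^{11},q^{13})-q\,f(q^5,q^{19})}{\varphi(q)},\qquad \frac{f(q,q^7)}{\varphi(q^2)}=\frac{f(q^7,q^{17})-q^2f(q,q^{23})}{\varphi(q)}.$$
   Context: $f(u,v)=\sum_{j=-\infty}^\infty u^{j(j-1)/2}v^{j(j+1)/2}$ and $\varphi(q)=\prod_{j=1}^\infty(1-q^j)$. *)

(* Defs.v *)
From HB Require Import structures.
From mathcomp Require Import all_boot all_order all_algebra.
From mathcomp Require Import all_classical zify.

Set Implicit Arguments.
Unset Strict Implicit.
Unset Printing Implicit Defensive.

Import Order.TTheory GRing.Theory Num.Theory.

Local Open Scope classical_set_scope.
Local Open Scope ring_scope.

Record fps (R : Type) := FPS { coefps : nat -> R }.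

Lemma fpsP (R : Type) (a b : fps R) : coefps a =1 coefps b <-> a = b.
Proof.
split=> [|-> //]; case: a b => [a] [b] /= ab.
by congr FPS; apply/funext.
Qed.

HB.instance Definition _ (R : Type) := gen_eqMixin (fps R).
HB.instance Definition _ (R : Type) := gen_choiceMixin (fps R).

Definition fps0 (R : nmodType) : fps R := FPS (fun=> 0).
Definition fps_opp (R : zmodType) (a : fps R) : fps R :=
  FPS (fun n => - coefps a n).
Definition fps_add (R : nmodType) (a b : fps R) : fps R :=
  FPS (fun n => coefps a n + coefps b n).

Lemma fps_addA (R : zmodType) : associative (@fps_add R).
Proof. by move=> a b c; apply/fpsP=> n /=; rewrite addrA. Qed.
Lemma fps_addC (R : zmodType) : commutative (@fps_add R).
Proof. by move=> a b; apply/fpsP=> n /=; rewrite addrC. Qed.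
Lemma fps_add0 (R : zmodType) : left_id (@fps0 R) (@fps_add R).
Proof. by move=> a; apply/fpsP=> n /=; rewrite add0r. Qed.
Lemma fps_addN (R : zmodType) :
  left_inverse (@fps0 R) (@fps_opp R) (@fps_add R).
Proof. by move=> a; apply/fpsP=> n /=; rewrite addNr. Qed.

HB.instance Definition _ (R : zmodType) := GRing.isZmodule.Build (fps R)
  (@fps_addA R) (@fps_addC R) (@fps_add0 R) (@fps_addN R).

Definition fps1 (R : nzRingType) : fps R := FPS (fun n => (n == 0)%:R).
Definition fps_mul (R : nzRingType) (a b : fps R) : fps R :=
  FPS (fun n => \sum_(i < n.+1) coefps a i * coefps b (n - i)).

Definition fps_trunc (R : nzRingType) (N : nat) (a : fps R) : {poly R} :=
  \poly_(i < N) coefps a i.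

Lemma coef_fps_mul_trunc (R : nzRingType) (N n : nat) (a b : fps R) :
  (n < N)%N -> coefps (fps_mul a b) n = (fps_trunc N a * fps_trunc N b)`_n.
Proof.
move=> nN; rewrite coefM; apply: eq_bigr => i _.
by rewrite !coef_poly !(leq_ltn_trans _ nN) ?leq_subr // -ltnS.
Qed.

Lemma fps_mulC (R : comNzRingType) : commutative (@fps_mul R).
Proof.
move=> a b; apply/fpsP=> n.
by rewrite !(@coef_fps_mul_trunc _ n.+1) // mulrC.
Qed.

Lemma fps_mulA (R : comNzRingType) : associative (@fps_mul R).
Proof.
move=> a b c; apply/fpsP=> n.
have H (x y z : fps R) : coefps (fps_mul x (fps_mul y z)) n =
    (fps_trunc n.+1 x * (fps_trunc n.+1 y * fps_trunc n.+1 z))`_n.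
  rewrite /= coefM; apply: eq_bigr => i _; rewrite coef_poly ltn_ord.
  by rewrite -coef_fps_mul_trunc ?ltnS ?leq_subr.
rewrite H [in RHS]fps_mulC H; congr (_`_n).
by rewrite mulrA mulrC.
Qed.

Lemma fps_mul1 (R : comNzRingType) : left_id (@fps1 R) (@fps_mul R).
Proof.
move=> a; apply/fpsP=> n /=; rewrite big_ord_recl /= mul1r subn0.
by rewrite big1 ?addr0 // => i _; rewrite mul0r.
Qed.

Lemma fps_mulD (R : comNzRingType) :
  left_distributive (@fps_mul R) (@fps_add R).
Proof.
move=> a b c; apply/fpsP=> n /=; rewrite -big_split /=.
by apply: eq_bigr => i _; rewrite mulrDl.
Qed.

Lemma fps1_neq0 (R : comNzRingType) : @fps1 R != 0.
Proof.
by apply/eqP=> /fpsP /(_ 0%N) /eqP; rewrite /= oner_eq0.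
Qed.

HB.instance Definition _ (R : comNzRingType) :=
  GRing.Zmodule_isComNzRing.Build (fps R)
    (@fps_mulA R) (@fps_mulC R) (@fps_mul1 R) (@fps_mulD R) (@fps1_neq0 R).

Definition fps_unit (R : comUnitRingType) : pred (fps R) :=
  fun a => coefps a 0 \is a GRing.unit.

(* The first n.+1 coefficients of the inverse of a, obtained by solving
   a * b = 1 coefficient by coefficient. *)
Fixpoint fps_inv_seq (R : comUnitRingType) (a : fps R) (n : nat) : seq R :=
  if n is m.+1 then
    let s := fps_inv_seq a m in
    rcons s (- (coefps a 0)^-1 * \sum_(i < m.+1) s`_i * coefps a (m.+1 - i))
  else [:: (coefps a 0)^-1].

(* Non-units are left fixed, as the unitRingType interface requires. *)
Definition fps_inv (R : comUnitRingType) (a : fps R) : fps R :=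
  if fps_unit a then FPS (fun n => (fps_inv_seq a n)`_n) else a.

Lemma size_fps_inv_seq (R : comUnitRingType) (a : fps R) (n : nat) :
  size (fps_inv_seq a n) = n.+1.
Proof. by elim: n => //= n IH; rewrite size_rcons IH. Qed.

Lemma nth_fps_inv_seq (R : comUnitRingType) (a : fps R) (n i : nat) :
  (i <= n)%N -> (fps_inv_seq a n)`_i = (fps_inv_seq a i)`_i.
Proof.
elim: n => [|n IH]; first by rewrite leqn0 => /eqP ->.
rewrite leq_eqVlt => /orP[/eqP -> //|]; rewrite ltnS => le_in.
by rewrite /= nth_rcons size_fps_inv_seq ltnS le_in IH.
Qed.

Lemma fps_mulV (R : comUnitRingType) :
  {in @fps_unit R, left_inverse 1 (@fps_inv R) *%R}.
Proof.
move=> a ua; have ua' : fps_unit a by [].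
apply/fpsP=> -[|n]; rewrite /= /fps_inv ua' /=.
  by rewrite big_ord1 /= mulVr.
rewrite big_ord_recr /= subnn nth_rcons size_fps_inv_seq ltnn eqxx.
rewrite mulrAC mulNr mulVr // mulN1r; apply/eqP; rewrite subr_eq0; apply/eqP.
by apply: eq_bigr => i _; rewrite [in RHS]nth_fps_inv_seq // -ltnS.
Qed.

Lemma fps_unitPl (R : comUnitRingType) (a b : fps R) :
  b * a = 1 -> fps_unit a.
Proof.
move=> /fpsP /(_ 0%N); rewrite /= big_ord1 /= => ba1.
by apply/unitrPr; exists (coefps b 0); rewrite mulrC.
Qed.

Lemma fps_inv_out (R : comUnitRingType) :
  {in [predC @fps_unit R], @fps_inv R =1 id}.
Proof. by move=> a na; rewrite /fps_inv; case: ifP na => // ua /negP[]. Qed.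

HB.instance Definition _ (R : comUnitRingType) :=
  GRing.ComNzRing_hasMulInverse.Build (fps R)
    (@fps_mulV R) (@fps_unitPl R) (@fps_inv_out R).

Definition fpsX (R : nzRingType) : fps R := FPS (fun n => (n == 1)%:R).

(* Convergence is coefficientwise, for the discrete topology on R.  An infinite
   sum converges when, for each n, only finitely many terms have a nonzero
   coefficient at n; otherwise that coefficient is 0 by convention of the
   finitely supported sum. *)
Definition fps_summable (R : nmodType) (I : choiceType) (F : I -> fps R) :=
  forall n, finite_set [set i | coefps (F i) n != 0].

Definition fps_sum (R : nmodType) (I : choiceType) (F : I -> fps R) : fps R :=
  FPS (fun n => \sum_(i \in [set: I]) coefps (F i) n).

Definition fps_cvg_to (R : Type) (S : nat -> fps R) (l : fps R) :=
  forall n, exists N, forall k, (N <= k)%N -> coefps (S k) n = coefps l n.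

Definition fps_lim (R : nmodType) (S : nat -> fps R) : fps R :=
  xget (@fps0 R) [set l | fps_cvg_to S l].

Definition theta_term (R : comNzRingType) (u v : fps R) (j : int) : fps R :=
  u ^+ `|(j * (j - 1) %/ 2)%Z|%N * v ^+ `|(j * (j + 1) %/ 2)%Z|%N.

Definition theta (R : comNzRingType) (u v : fps R) : fps R :=
  fps_sum (theta_term u v).

Definition euler_phi_partial (R : comNzRingType) (x : fps R) (k : nat) :=
  \prod_(1 <= j < k.+1) (1 - x ^+ j).

Definition euler_phi (R : comNzRingType) (x : fps R) : fps R :=
  fps_lim (euler_phi_partial x).

Lemma coefps_exp_lt (R : comNzRingType) (a x : fps R) (k n : nat) :
  coefps x 0 = 0 -> (n < k)%N -> coefps (a * x ^+ k) n = 0.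
Proof.
move=> x0; elim: k a n => // k IH a n ltnk.
rewrite exprSr mulrA /= big1 // => i _.
have [->|ni] := eqVneq (nat_of_ord i) n; first by rewrite subnn x0 mulr0.
rewrite [X in X * _]IH ?mul0r //.
by have := ltn_ord i; move/eqP: ni; lia.
Qed.

Lemma theta_summable (R : comNzRingType) (u v : fps R) :
  coefps u 0 = 0 -> coefps v 0 = 0 -> fps_summable (theta_term u v).
Proof.
move=> u0 v0 n; pose s := [seq i%:Z - n.+2%:Z | i <- iota 0 (n.+2 + n.+3)].
have sP (j : int) : (`|j| <= n.+2)%N -> j \in s.
  move=> jn; apply/mapP; exists `|(j + n.+2%:Z)%R|%N; last by lia.
  by rewrite mem_iota; lia.
apply: (@sub_finite_set _ _ [set` s]); last exact: finite_seq.
move=> j; rewrite /mkset; have [/sP //|jn] := leqP `|j|%N n.+2.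
apply: contraNP => _; apply/eqP; have [j0|j0] := lerP 0 j.
  apply: coefps_exp_lt => //.
  have : 2 * (n.+1)%:Z <= j * (j + 1) by nia.
  by lia.
rewrite /theta_term mulrC; apply: coefps_exp_lt => //.
have : 2 * (n.+1)%:Z <= j * (j - 1) by nia.
by lia.
Qed.

Lemma fps_cvg_unique (R : Type) (S : nat -> fps R) (l m : fps R) :
  fps_cvg_to S l -> fps_cvg_to S m -> l = m.
Proof.
move=> Sl Sm; apply/fpsP => n; have [N Nl] := Sl n; have [M Mm] := Sm n.
by rewrite -(Nl (maxn N M)) ?leq_maxl // Mm // leq_maxr.
Qed.

Lemma coefpsB (R : zmodType) (a b : fps R) (n : nat) :
  coefps (a - b) n = coefps a n - coefps b n.
Proof. by []. Qed.

Lemma euler_phi_partialS (R : comNzRingType) (x : fps R) (k : nat) :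
  euler_phi_partial x k.+1
    = euler_phi_partial x k - euler_phi_partial x k * x ^+ k.+1.
Proof. by rewrite /euler_phi_partial big_nat_recr //= mulrBr mulr1. Qed.

Lemma euler_phi_cvg (R : comNzRingType) (x : fps R) :
  coefps x 0 = 0 -> fps_cvg_to (euler_phi_partial x) (euler_phi x).
Proof.
move=> x0; rewrite /euler_phi /fps_lim; apply: xgetPex.
exists (FPS (fun n => coefps (euler_phi_partial x n) n)) => n.
exists n; elim=> [|k IH]; first by rewrite leqn0 => /eqP ->.
rewrite leq_eqVlt => /orP[/eqP -> //|]; rewrite ltnS => nk.
by rewrite -IH // euler_phi_partialS coefpsB coefps_exp_lt // subr0.
Qed.

Lemma euler_phi_unit (R : comUnitRingType) (x : fps R) :
  coefps x 0 = 0 -> euler_phi x \is a GRing.unit.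
Proof.
move=> x0; have [N] := euler_phi_cvg x0 0; move/(_ N (leqnn _)) => phi0.
rewrite unfold_in /= /fps_unit -phi0.
suff -> : coefps (euler_phi_partial x N) 0 = 1 by exact: unitr1.
elim: N {phi0} => [|k IH]; first by rewrite /euler_phi_partial big_nil.
by rewrite euler_phi_partialS coefpsB coefps_exp_lt // subr0.
Qed.

(* Main.v *)
(** Both identities are the quintuple product identity with base q^8, at z = q
    and at z = q^3.  The Jacobi triple product, obtained as the limit of its
    finite q-binomial form, turns
      theta(-q^a, -q^b) theta(-q^(3a+b), -q^(b-a))      (a + b = 8, a = 1 or 3)
    into euler_phi(q^16) theta(q^((3a+b)/2), q^((b-a)/2))
    euler_phi(q) / euler_phi(q^2).  On the other hand this product is a double
    series over (i, j), which splits along the classes of i - j modulo 3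
    (Carlitz-Subbarao): one class cancels and, by the pentagonal number theorem,
    the other two give euler_phi(q^16) times the difference of theta series on
    the right. *)

Require Import Defs.
From mathcomp Require Import all_boot all_order all_algebra.
From mathcomp Require Import all_classical zify ring.

Set Implicit Arguments.
Unset Strict Implicit.
Unset Printing Implicit Defensive.

Import Order.TTheory GRing.Theory Num.Theory.

Local Open Scope ring_scope.

(** * Coefficientwise congruence and limits *)

Definition fps_eqn (R : Type) (n : nat) (a b : fps R) :=
  forall i, (i <= n)%N -> coefps a i = coefps b i.

Section Congruence.
Variable R : comNzRingType.
Implicit Types (a b c d : fps R) (S T : nat -> fps R) (n : nat).

Lemma coefpsM a b n :
  coefps (a * b) n = \sum_(i < n.+1) coefps a i * coefps b (n - i).
Proof. by []. Qed.

Lemma coefps0M a b : coefps (a * b) 0 = coefps a 0 * coefps b 0.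
Proof. by rewrite coefpsM big_ord1. Qed.

Lemma coefps0_exp a n : coefps a 0 = 0 -> (0 < n)%N -> coefps (a ^+ n) 0 = 0.
Proof. by case: n => // n a0 _; rewrite exprS coefps0M a0 mul0r. Qed.

Lemma coefps_sum (I : Type) (r : seq I) (F : I -> fps R) n :
  coefps (\sum_(i <- r) F i) n = \sum_(i <- r) coefps (F i) n.
Proof. by rewrite (big_morph (fun a => coefps a n) (id1 := 0) (op1 := +%R)). Qed.

Lemma fps_eqn_refl n a : fps_eqn n a a.
Proof. by []. Qed.

Lemma fps_eqn_sym n a b : fps_eqn n a b -> fps_eqn n b a.
Proof. by move=> ab i /ab. Qed.

Lemma fps_eqnM n a b c d :
  fps_eqn n a b -> fps_eqn n c d -> fps_eqn n (a * c) (b * d).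
Proof.
move=> ab cd i ni; rewrite !coefpsM; apply: eq_bigr => -[k /= ki] _.
by rewrite ab ?cd //; lia.
Qed.

Lemma fps_eqn_exp0 n a x k :
  coefps x 0 = 0 -> (n < k)%N -> fps_eqn n (a * x ^+ k) 0.
Proof. by move=> x0 nk i ni; rewrite coefps_exp_lt // (leq_ltn_trans ni). Qed.

(** Taking the maximum of the thresholds for the indices up to [n] settles all these coefficients at
    once, which products need because coefficient [n] of a product involves all lower ones. *)
Lemma fps_cvg_eqn S l : fps_cvg_to S l ->
  forall n, exists N, forall k, (N <= k)%N -> fps_eqn n (S k) l.
Proof.
move=> Sl; elim=> [|n [N IH]]; first have [N SN] := Sl 0%N.
  by exists N => k /SN Sk i; rewrite leqn0 => /eqP ->.
have [M SM] := Sl n.+1; exists (maxn N M) => k.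
rewrite geq_max => /andP[Nk Mk] i; rewrite leq_eqVlt => /predU1P[-> | ni].
  exact: SM.
exact: IH.
Qed.

Lemma fps_cvg_cst a : fps_cvg_to (fun=> a) a.
Proof. by move=> n; exists 0%N. Qed.

Lemma fps_cvgM S T l m :
  fps_cvg_to S l -> fps_cvg_to T m -> fps_cvg_to (fun k => S k * T k) (l * m).
Proof.
move=> /fps_cvg_eqn Sl /fps_cvg_eqn Tm n.
have [[N NS] [M MT]] := (Sl n, Tm n); exists (maxn N M) => k.
by rewrite geq_max => /andP[/NS Nk /MT Mk]; apply: (fps_eqnM Nk Mk).
Qed.

Lemma fps_cvg_prod (I : Type) (r : seq I) (S : I -> nat -> fps R) (l : I -> fps R) :
  (forall i, fps_cvg_to (S i) (l i)) ->
  fps_cvg_to (fun k => \prod_(i <- r) S i k) (\prod_(i <- r) l i).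
Proof.
move=> Sl; elim: r => [|i r IH] n; first by exists 0%N => k _; rewrite !big_nil.
by have [N H] := fps_cvgM (Sl i) IH n; exists N => k /H; rewrite !big_cons.
Qed.

Lemma fps_cvg_comp S l (f : nat -> nat) :
  (forall k, (k <= f k)%N) -> fps_cvg_to S l -> fps_cvg_to (S \o f) l.
Proof.
move=> kf Sl n; have [N SN] := Sl n; exists N => k Nk /=.
by rewrite SN // (leq_trans Nk).
Qed.

Lemma eq_fps_cvg S T l : S =1 T -> fps_cvg_to S l -> fps_cvg_to T l.
Proof. by move=> /funext ->. Qed.

End Congruence.

(** * q-shifted factorials *)

Section Pochhammer.
Variable R : comNzRingType.
Implicit Types x Q : fps R.

(** The q-Pochhammer symbol $(x;Q)_k$; [qpoch] is $(x;Q)_\infty$. *)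
Definition qpoch_partial x Q (k : nat) := \prod_(i < k) (1 - x * Q ^+ i).

Definition qpoch x Q : fps R := fps_lim (qpoch_partial x Q).

Lemma qpoch_partialS x Q k :
  qpoch_partial x Q k.+1 = qpoch_partial x Q k * (1 - x * Q ^+ k).
Proof. by rewrite /qpoch_partial big_ord_recr. Qed.

Lemma qpoch_cvg x Q :
  coefps Q 0 = 0 -> fps_cvg_to (qpoch_partial x Q) (qpoch x Q).
Proof.
move=> Q0; rewrite /qpoch /fps_lim; apply: xgetPex.
(* The factor with [i = n] can still change coefficient [n], hence the cut at [n.+1]. *)
exists (FPS (fun n => coefps (qpoch_partial x Q n.+1) n)) => n.
exists n.+1; elim=> // k IH.
rewrite leq_eqVlt => /predU1P[<- //|]; rewrite ltnS => nk.
rewrite -IH // qpoch_partialS mulrBr mulr1 mulrA coefpsB coefps_exp_lt //.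
by rewrite subr0.
Qed.

Lemma qpoch_partial_euler Q k : qpoch_partial Q Q k = euler_phi_partial Q k.
Proof.
rewrite /euler_phi_partial big_add1 big_mkord.
by apply: eq_bigr => i _; rewrite -exprS.
Qed.

Lemma euler_phiE Q : euler_phi Q = qpoch Q Q.
Proof.
by congr fps_lim; apply/funext => k; rewrite qpoch_partial_euler.
Qed.

(** The factors are sorted by the residue of their exponent modulo [m]; the first [k * m] factors on
    the left are exactly the first [k] of every class. *)
Lemma qpoch_dissect m x Q : (0 < m)%N -> coefps Q 0 = 0 ->
  qpoch x Q = \prod_(r < m) qpoch (x * Q ^+ r) (Q ^+ m).
Proof.
move=> m0 Q0; have Qm0 := coefps0_exp Q0 m0.
apply: (@fps_cvg_unique _ (qpoch_partial x Q \o muln^~ m)).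
  by apply: fps_cvg_comp (qpoch_cvg x Q0) => k; rewrite leq_pmulr.
apply: (@eq_fps_cvg _ (fun k =>
    \prod_(r < m) qpoch_partial (x * Q ^+ r) (Q ^+ m) k)); last first.
  by apply: fps_cvg_prod => r; apply: qpoch_cvg.
elim=> [|k IH] /=.
  by rewrite big1 // => [|i _]; rewrite /qpoch_partial big_ord0.
rewrite /= in IH; under eq_bigr do rewrite qpoch_partialS.
rewrite big_split /= IH /qpoch_partial mulSnr big_split_ord /=.
by congr (_ * _); apply: eq_bigr => i _; rewrite -mulrA -exprM -exprD addnC mulnC.
Qed.

Lemma qpoch_mulN x Q : coefps Q 0 = 0 ->
  qpoch x Q * qpoch (- x) Q = qpoch (x ^+ 2) (Q ^+ 2).
Proof.
move=> Q0; apply: fps_cvg_unique (fps_cvgM (qpoch_cvg _ Q0) (qpoch_cvg _ Q0)) _.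
apply: eq_fps_cvg (qpoch_cvg _ (coefps0_exp Q0 _)) => // k.
rewrite -big_split; apply: eq_bigr => i _ /=; rewrite exprAC.
by ring.
Qed.

End Pochhammer.

(** * Infinite sums *)

Section Sums.
Variable R : comNzRingType.

Lemma coefps_fps_sum (I : choiceType) (s : seq I) (F : I -> fps R) n :
    uniq s -> (forall i, coefps (F i) n != 0 -> i \in s) ->
  coefps (fps_sum F) n = \sum_(i <- s) coefps (F i) n.
Proof.
move=> us sF; rewrite (@bigfs _ _ +%R _ s xpredT) // => [|i _].
  by apply: eq_fsbigl; apply/seteqP.
by apply: contraNeq => /sF.
Qed.

(** A single list must serve all coefficients up to [n], since those of a product mix them. *)
Lemma fps_summable_seq (I : choiceType) (F : I -> fps R) n : fps_summable F ->
  exists2 s, uniq s &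
    forall i k, (k <= n)%N -> coefps (F i) k != 0 -> i \in s.
Proof.
move=> sF; have /finite_seqP[s Es] : finite_set
    (\bigcup_(k in `I_n.+1) [set i | coefps (F i) k != 0])%classic.
  by apply: bigcup_finite => [|k _]; [exact: finite_II | exact: sF].
exists (undup s) => [|i k kn Fi]; first exact: undup_uniq.
have : [set` s]%classic i by rewrite -Es; exists k.
by rewrite mem_undup.
Qed.

Lemma fps_sum_reindex (I J : choiceType) (h : I -> J) (F : J -> fps R) :
  bijective h -> fps_sum F = fps_sum (F \o h).
Proof.
by move=> hbij; congr FPS; apply/funext => n; apply: reindex_fsbigT.
Qed.

Lemma fps_summable_inj (I J : choiceType) (h : I -> J) (F : J -> fps R) :
  injective h -> fps_summable F -> fps_summable (F \o h).
Proof.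
move=> hinj sF n; apply: (finite_preimage _ (sF n)).
by move=> x y _ _; apply: hinj.
Qed.

Lemma coefpsM_neq0 (a b : fps R) n : coefps (a * b) n != 0 ->
  exists k, [/\ (k <= n)%N, coefps a k != 0 & coefps b (n - k) != 0].
Proof.
move=> abn; have [|H] := pselect (exists k : 'I_n.+1,
    coefps a k != 0 /\ coefps b (n - k) != 0).
  by case=> -[k kn] /= [ak bk]; exists k.
case/eqP: abn; rewrite coefpsM big1 // => k _; apply/eqP.
rewrite -[_ == 0]negbK; apply/negP => abk; case: H; exists k.
by split; apply: contraNneq abk => ->; rewrite (mul0r, mulr0).
Qed.

Lemma fps_summable_mull (I : choiceType) (F : I -> fps R) a :
  fps_summable F -> fps_summable (fun i => a * F i).
Proof.
move=> sF n; have [s us sP] := fps_summable_seq n sF.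
apply: (@sub_finite_set _ _ [set` s]%classic); last exact: finite_seq.
move=> i /coefpsM_neq0[k [_ _]]; apply: sP; exact: leq_subr.
Qed.

Lemma fps_sum_mull (I : choiceType) (F : I -> fps R) a :
  fps_summable F -> fps_sum (fun i => a * F i) = a * fps_sum F.
Proof.
move=> sF; apply/fpsP => n; have [s us sP] := fps_summable_seq n sF.
rewrite (coefps_fps_sum us) => [|i /coefpsM_neq0[k [_ _]]]; last first.
  by apply: sP; exact: leq_subr.
under eq_bigr do rewrite coefpsM.
rewrite coefpsM exchange_big; apply: eq_bigr => k _.
rewrite (coefps_fps_sum us) ?mulr_sumr // => i; apply: sP; exact: leq_subr.
Qed.

Section Product.
Variables (I J : choiceType) (F : I -> fps R) (G : J -> fps R).
Hypotheses (sF : fps_summable F) (sG : fps_summable G).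

Let FG p := F p.1 * G p.2.

Let FG_support n : exists s t,
  [/\ uniq s, uniq t,
      forall i k, (k <= n)%N -> coefps (F i) k != 0 -> i \in s,
      forall j k, (k <= n)%N -> coefps (G j) k != 0 -> j \in t &
      forall p, coefps (FG p) n != 0 -> p \in allpairs pair s t].
Proof.
have [s us sP] := fps_summable_seq n sF; have [t ut tP] := fps_summable_seq n sG.
exists s, t; split=> // -[i j] /coefpsM_neq0[k [kn /sP si /tP tj]].
by apply/allpairsP; exists (i, j); rewrite si // tj // leq_subr.
Qed.

Lemma fps_summable_mul : fps_summable FG.
Proof.
move=> n; have [s [t [_ _ _ _ stP]]] := FG_support n.
by apply: (@sub_finite_set _ _ [set` allpairs pair s t]%classic).
Qed.

Lemma fps_sum_mul : fps_sum F * fps_sum G = fps_sum FG.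
Proof.
apply/fpsP => n; have [s [t [us ut sP tP stP]]] := FG_support n.
rewrite (coefps_fps_sum _ stP); last first.
  by apply: allpairs_uniq => // -[i j] [i' j'].
rewrite big_allpairs coefpsM.
under [RHS]eq_bigr do under eq_bigr do rewrite coefpsM.
under [RHS]eq_bigr do rewrite exchange_big /=.
rewrite exchange_big; apply: eq_bigr => -[k kn] _.
rewrite (coefps_fps_sum us) => [|i]; last exact: sP.
rewrite (coefps_fps_sum ut) => [|j]; last by apply: tP; exact: leq_subr.
by rewrite mulr_suml; apply: eq_bigr => i _; rewrite mulr_sumr.
Qed.

End Product.

Lemma fps_sum_partition (T : finType) (J K : choiceType) (h : T * K -> J)
    (F : J -> fps R) :
  bijective h -> fps_summable F ->
  fps_sum F = \sum_t fps_sum (fun k => F (h (t, k))).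
Proof.
move=> hbij sF; rewrite (fps_sum_reindex _ hbij); apply/fpsP => n.
have [s _ sP] := fps_summable_seq n (fps_summable_inj (bij_inj hbij) sF).
(* The support is enclosed in a finite rectangle: every class, times the second coordinates
   occurring in [s]. *)
rewrite (@coefps_fps_sum _ (allpairs pair (enum T) (undup (map snd s)))).
- rewrite big_allpairs coefps_sum big_enum; apply: eq_bigr => t _.
  rewrite (@coefps_fps_sum _ (undup (map snd s))) ?undup_uniq // => k Fk.
  by rewrite mem_undup; apply/mapP; exists (t, k) => //; apply: (sP _ n).
- by apply: allpairs_uniq; rewrite ?enum_uniq ?undup_uniq // => -[? ?] [? ?].
- move=> [t k] Ftk; apply/allpairsP; exists (t, k); split=> //=.
    by rewrite mem_enum.
  by rewrite mem_undup; apply/mapP; exists (t, k) => //; apply: (sP _ n).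
Qed.

End Sums.

(** * The Jacobi triple product *)

Section ThetaTerms.
Variable R : comNzRingType.
Implicit Types (u v x : fps R) (j : int).

(** One of [j] and [j - 1] is even. Describing exponents by their doubles keeps the quotient and the
    absolute value of [theta_term] out of later arithmetic. *)
Lemma triangular_nat j : exists e : nat, (2 * e)%:Z = j * (j - 1).
Proof.
have [k [->|->]] : exists k : int, j = 2 * k \/ j = 2 * k + 1.
- by exists (j %/ 2)%Z; lia.
- by exists `|(k * (2 * k - 1))%R|%N; nia.
- by exists `|(k * (2 * k + 1))%R|%N; nia.
Qed.

Lemma theta_termE u v j (a b : nat) :
  (2 * a)%:Z = j * (j - 1) -> (2 * b)%:Z = j * (j + 1) ->
  theta_term u v j = u ^+ a * v ^+ b.
Proof. by move=> ja jb; rewrite /theta_term; congr (_ ^+ _ * _ ^+ _); lia. Qed.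

Lemma theta_termP u v j : exists a b : nat,
  [/\ (2 * a)%:Z = j * (j - 1), (2 * b)%:Z = j * (j + 1)
    & theta_term u v j = u ^+ a * v ^+ b].
Proof.
have [a ja] := triangular_nat j; have [b jb] := triangular_nat (j + 1).
have {}jb : (2 * b)%:Z = j * (j + 1) by rewrite jb; ring.
by exists a, b; split=> //; apply: theta_termE.
Qed.

Lemma theta_termN u v j : theta_term u v (- j) = theta_term v u j.
Proof.
have [a [b [ja jb ->]]] := theta_termP v u j.
by rewrite mulrC; apply: theta_termE; [rewrite jb | rewrite ja]; ring.
Qed.

Lemma thetaC u v : theta u v = theta v u.
Proof.
rewrite /theta (@fps_sum_reindex _ _ _ -%R); last by exists -%R; exact: opprK.
by congr fps_sum; apply/funext => j; exact: theta_termN.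
Qed.

(** With $j = k - n$, the ratio of the terms at $j+1$ and $j$ is formally $v(uv)^j$. The bound on
    [k] makes the remaining exponent $m - j$ a natural number. *)
Lemma theta_termS u v (k m n : nat) : (k <= m + n)%N ->
  theta_term u v (k%:Z - n%:Z) * (v * (u * v) ^+ m)
    = (u * v) ^+ (m + n - k) * theta_term u v (k.+1%:Z - n%:Z).
Proof.
move=> kmn; set j := k%:Z - n%:Z.
have [a [b [ja jb ->]]] := theta_termP u v j.
have [c [d [jc jd ->]]] := theta_termP u v (k.+1%:Z - n%:Z).
have jS : k.+1%:Z - n%:Z = j + 1 by rewrite /j; lia.
rewrite {}jS in jc jd; rewrite !exprMn [RHS]mulrACA -!exprD.
have -> : u ^+ a * v ^+ b * (v * (u ^+ m * v ^+ m))
    = u ^+ (a + m) * v ^+ (b.+1 + m) by rewrite !exprD exprS; ring.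
have jm : (m + n - k)%N%:Z = m%:Z - j by rewrite /j; lia.
by congr (_ ^+ _ * _ ^+ _); nia.
Qed.

Lemma theta_term_eqn0 u v j n : coefps u 0 = 0 -> coefps v 0 = 0 ->
  (n.+1 < `|j|)%N -> fps_eqn n (theta_term u v j) 0.
Proof.
move=> u0 v0 nj; have [a [b [ja jb ->]]] := theta_termP u v j.
have [j0|j0] := lerP 0 j; first by apply: fps_eqn_exp0 => //; nia.
by rewrite mulrC; apply: fps_eqn_exp0 => //; nia.
Qed.

(** The window from [-N] to [N] is the range of the finite triple product with [m = n = N]. *)
Lemma coefps_theta u v n N : coefps u 0 = 0 -> coefps v 0 = 0 -> (n < N)%N ->
  coefps (theta u v) n
    = \sum_(k < (N + N).+1) coefps (theta_term u v (k%:Z - N%:Z)) n.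
Proof.
move=> u0 v0 nN.
rewrite (@coefps_fps_sum _ _ [seq k%:Z - N%:Z | k <- iota 0 (N + N).+1]).
- by rewrite big_map -[iota _ _]/(index_iota 0 (N + N).+1) big_mkord.
- by rewrite map_inj_uniq ?iota_uniq // => k l; lia.
- move=> j; have [jN _|jN] := leqP `|j| N.
    by apply/mapP; exists `|(j + N%:Z)%R|%N; [rewrite mem_iota; lia | lia].
  by rewrite (theta_term_eqn0 u0 v0 (leq_ltn_trans nN jN)) ?eqxx.
Qed.

End ThetaTerms.

(** * Gaussian binomials, the finite triple product and its limit *)

Section TripleProduct.
Variable R : comUnitRingType.
Implicit Types (u v a b x Q : fps R) (n m k : nat).

Lemma fps_eqnV n a b : a \is a GRing.unit -> b \is a GRing.unit ->
  fps_eqn n a b -> fps_eqn n a^-1 b^-1.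
Proof.
(* Written as $a^{-1} b b^{-1}$ and $a^{-1} a b^{-1}$, the two inverses differ only in the middle
   factor. *)
move=> ua ub ab; rewrite -[a^-1]mulr1 -(mulrV ub) -[X in fps_eqn n _ X]mul1r.
rewrite -(mulVr ua) mulrA; apply: fps_eqnM => //.
by apply: fps_eqnM => //; exact: fps_eqn_sym.
Qed.

Lemma coefps0_qpoch_partial Q k :
  coefps Q 0 = 0 -> coefps (qpoch_partial Q Q k) 0 = 1.
Proof.
move=> Q0; elim: k => [|k IH]; first by rewrite /qpoch_partial big_ord0.
by rewrite qpoch_partialS coefps0M IH coefpsB coefps0M Q0 mul0r subr0 mulr1.
Qed.

Lemma qpoch_partial_unit Q k :
  coefps Q 0 = 0 -> qpoch_partial Q Q k \is a GRing.unit.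
Proof.
by move=> Q0; rewrite unfold_in /= /fps_unit coefps0_qpoch_partial ?unitr1.
Qed.

(** The Gaussian binomial of [m + n] over [m], indexed by the two parts so that it is visibly
    symmetric. *)
Definition qbinom Q m n :=
  qpoch_partial Q Q (m + n) / (qpoch_partial Q Q m * qpoch_partial Q Q n).

Lemma qbinomC Q m n : qbinom Q m n = qbinom Q n m.
Proof. by rewrite /qbinom addnC [X in _ / X]mulrC. Qed.

Lemma qbinom0 Q n : coefps Q 0 = 0 -> qbinom Q 0 n = 1.
Proof.
move=> Q0; rewrite /qbinom add0n {2}/qpoch_partial big_ord0 mul1r divrr //.
exact: qpoch_partial_unit.
Qed.

(** Clearing denominators leaves $1 - Q^{m+n+2} = (1 - Q^{n+1}) + Q^{n+1}(1 - Q^{m+1})$. *)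
Lemma qbinom_pascal Q m n : coefps Q 0 = 0 ->
  qbinom Q m.+1 n.+1 = qbinom Q m.+1 n + Q ^+ n.+1 * qbinom Q m n.+1.
Proof.
move=> Q0; have uP k := qpoch_partial_unit k Q0.
have uPP k l : qpoch_partial Q Q k * qpoch_partial Q Q l \is a GRing.unit.
  by rewrite unitrM !uP.
have frac k l a : qbinom Q k l * (qpoch_partial Q Q k * qpoch_partial Q Q l * a)
    = qpoch_partial Q Q (k + l) * a by rewrite /qbinom mulrA divrK.
apply: (mulIr (uPP m.+1 n.+1)); rewrite mulrDl divrK //.
have e1 : qpoch_partial Q Q m.+1 * qpoch_partial Q Q n.+1
    = qpoch_partial Q Q m.+1 * qpoch_partial Q Q n * (1 - Q ^+ n.+1).
  by rewrite (qpoch_partialS Q Q n) -exprS mulrA.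
have e2 : qpoch_partial Q Q m.+1 * qpoch_partial Q Q n.+1
    = qpoch_partial Q Q m * qpoch_partial Q Q n.+1 * (1 - Q ^+ m.+1).
  by rewrite !qpoch_partialS -!exprS; ring.
rewrite {1}e1 frac -[_ * qbinom _ _ _ * _]mulrA e2 frac.
rewrite addSn addnS qpoch_partialS -exprS -addSn -addnS exprD.
by ring.
Qed.

(** By [theta_termS] the new factor adds a copy of the sum shifted by one index. Inner terms merge
    by [qbinom_pascal]; at both ends the binomial is 1. *)
Lemma finite_triple_product_step u v m n : coefps (u * v) 0 = 0 ->
  (\sum_(k < (m + n).+1)
     qbinom (u * v) k (m + n - k) * theta_term u v (k%:Z - n%:Z))
    * (1 + v * (u * v) ^+ m)
  = \sum_(k < (m.+1 + n).+1)
      qbinom (u * v) k (m.+1 + n - k) * theta_term u v (k%:Z - n%:Z).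
Proof.
move=> Q0; set Q := u * v in Q0 *; set M := (m + n)%N.
rewrite mulrDr mulr1 {1}big_ord_recl subn0 qbinom0 // mul1r.
have -> : (\sum_(k < M.+1) qbinom Q k (M - k) * theta_term u v (k%:Z - n%:Z))
      * (v * Q ^+ m)
    = \sum_(k < M.+1) qbinom Q k (M - k)
        * (Q ^+ (M - k) * theta_term u v (k.+1%:Z - n%:Z)).
  rewrite mulr_suml; apply: eq_bigr => -[k kM] _ /=.
  by rewrite -mulrA theta_termS.
rewrite addSn -/M [RHS]big_ord_recl subn0 qbinom0 // mul1r -addrA; congr (_ + _).
rewrite [X in _ + X]big_ord_recr [RHS]big_ord_recr /= addrA !subnn.
rewrite expr0 !mul1r !(qbinomC _ _ 0) !qbinom0 //; congr (_ + _).
rewrite -big_split; apply: eq_bigr => -[k kM] _ /=.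
rewrite /bump add1n subSS; have -> : (M - k = (M - k.+1).+1)%N by lia.
by rewrite qbinom_pascal //; ring.
Qed.

(* Extending the product one factor at a time turns the claim into the q-Pascal
   rule; the exchange (u, v, k) -> (v, u, m + n - k) covers the other factor. *)
Lemma finite_triple_product u v m n : coefps (u * v) 0 = 0 ->
  qpoch_partial (- v) (u * v) m * qpoch_partial (- u) (u * v) n
    = \sum_(k < (m + n).+1)
        qbinom (u * v) k (m + n - k) * theta_term u v (k%:Z - n%:Z).
Proof.
elim: m u v n => [|m IH] u v n Q0; last first.
  rewrite -finite_triple_product_step // -IH // qpoch_partialS; ring.
have base x y : theta_term x y (0%:Z - 0%:Z) = 1.
  by rewrite (@theta_termE _ _ _ _ 0 0) ?mulr1.
elim: n u v Q0 => [|n IH] u v Q0.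
  rewrite /qpoch_partial !big_ord0 big_ord_recl big_ord0 qbinom0 //.
  by rewrite base !mulr1 addr0.
have sw x y k :
  \sum_(i < (0 + k).+1) qbinom (x * y) i (0 + k - i)
      * theta_term x y (i%:Z - k%:Z)
  = \sum_(i < (k + 0).+1) qbinom (y * x) i (k + 0 - i)
      * theta_term y x (i%:Z - 0%:Z).
  rewrite (reindex_inj rev_ord_inj) addn0 add0n /=.
  apply: eq_bigr => -[i ik] _ /=; rewrite qbinomC [y * x]mulrC -theta_termN.
  by congr (qbinom _ _ _ * theta_term _ _ _); lia.
rewrite sw -finite_triple_product_step; last by rewrite mulrC.
rewrite -sw -IH // qpoch_partialS [v * u]mulrC; ring.
Qed.

(* Both shifted factorials of a central q-binomial tend to euler_phi Q. *)
Lemma qbinom_eqn Q n : coefps Q 0 = 0 -> exists N, forall k l,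
  (N <= k)%N -> (N <= l)%N -> fps_eqn n (euler_phi Q * qbinom Q k l) 1.
Proof.
move=> Q0; have uphi := euler_phi_unit Q0.
have uP k := qpoch_partial_unit k Q0.
have := qpoch_cvg Q Q0; rewrite -euler_phiE => /fps_cvg_eqn/(_ n)[N PN].
exists N => k l Nk Nl; have -> : 1 = euler_phi Q *
    (euler_phi Q / (euler_phi Q * euler_phi Q)).
  by rewrite mulrA divrr ?unitrM ?uphi.
apply: fps_eqnM => //; apply: fps_eqnM; first by apply: PN; lia.
apply: fps_eqnV; rewrite ?unitrM ?uphi ?uP //.
by apply: fps_eqnM; apply: PN.
Qed.

Theorem jacobi_triple_product u v : coefps u 0 = 0 -> coefps v 0 = 0 ->
  theta u v = euler_phi (u * v) * (qpoch (- v) (u * v) * qpoch (- u) (u * v)).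
Proof.
move=> u0 v0; have Q0 : coefps (u * v) 0 = 0 by rewrite coefps0M u0 mul0r.
have cvgP := fps_cvgM (fps_cvg_cst (euler_phi (u * v)))
  (fps_cvgM (qpoch_cvg (- v) Q0) (qpoch_cvg (- u) Q0)).
apply: fps_cvg_unique cvgP => n; have [N0 gN] := qbinom_eqn n Q0.
(* The margin [n.+2] keeps [k] and [N + N - k] above [N0] whenever [k] is within [n.+1] of [N];
   there the binomial times [euler_phi] is 1 up to order [n]. All other terms vanish to that
   order. *)
exists (N0 + n.+2)%N => N NN; rewrite finite_triple_product // mulr_sumr.
rewrite (@coefps_theta _ _ _ _ N) //; last by lia.
rewrite coefps_sum; apply: eq_bigr => -[k kN] _; rewrite mulrA.
rewrite -[nat_of_ord _]/k; have [jn|jn] := leqP `|(k%:Z - N%:Z)%R| n.+1.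
  rewrite -[theta_term _ _ _ in RHS]mul1r.
  by apply: (@fps_eqnM _ n) => //; apply: gN; lia.
have t0 := theta_term_eqn0 u0 v0 jn.
by rewrite (fps_eqnM (fps_eqn_refl _) t0) // mulr0 t0.
Qed.

End TripleProduct.

(** * The quintuple product *)

Section MonomialTheta.
Variable R : comNzRingType.
Implicit Types (x : fps R) (j : int).

Lemma theta_term_expE x (a b : nat) j (e : nat) :
  (2 * e)%:Z = a%:Z * (j * (j - 1)) + b%:Z * (j * (j + 1)) ->
  theta_term (x ^+ a) (x ^+ b) j = x ^+ e.
Proof.
move=> je; have [c [d [jc jd ->]]] := theta_termP (x ^+ a) (x ^+ b) j.
by rewrite -!exprM -exprD; congr (_ ^+ _); nia.
Qed.

Lemma signr_eq (m n : nat) : odd m = odd n -> (-1) ^+ m = (-1) ^+ n :> fps R.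
Proof. by rewrite -signr_odd => ->; rewrite signr_odd. Qed.

Lemma theta_term_oppexpP x (a b : nat) j : exists e : nat,
  (2 * e)%:Z = a%:Z * (j * (j - 1)) + b%:Z * (j * (j + 1)) /\
  theta_term (- x ^+ a) (- x ^+ b) j = (-1) ^+ `|j|%N * x ^+ e.
Proof.
have [c [d [jc jd ->]]] := theta_termP (- x ^+ a) (- x ^+ b) j.
exists (a * c + b * d)%N; split; first by nia.
rewrite (exprNn _ c) (exprNn _ d) mulrACA -exprD -!exprM -exprD.
congr (_ * _); apply: signr_eq.
(* The two triangular exponents add up to $j^2$, which has the parity of $j$. *)
have -> : (c + d = `|j| * `|j|)%N by nia.
by rewrite oddM andbb.
Qed.

End MonomialTheta.

(** The triple product has base $Q^3$ here, and its three factors are the residue classes modulo 3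
    of the factors of [euler_phi Q]. *)
Theorem pentagonal_number (R : comUnitRingType) (Q : fps R) :
  coefps Q 0 = 0 -> theta (- Q) (- Q ^+ 2) = euler_phi Q.
Proof.
move=> Q0; have Q20 := coefps0_exp Q0 (ltn0Sn 1).
have N0 (y : fps R) : coefps y 0 = 0 -> coefps (- y) 0 = 0.
  by move=> y0; rewrite /= y0 oppr0.
rewrite jacobi_triple_product ?N0 // mulrNN !opprK -exprS !euler_phiE.
rewrite (@qpoch_dissect _ 3 Q Q) // !big_ord_recl big_ord0 expr0 expr1 /=.
by rewrite !mulr1 -expr2 -exprS; ring.
Qed.

(** Reindexing by [h] shows that the sum equals its opposite, and [int] has no 2-torsion. *)
Lemma fps_sum_antisymmetric (I : choiceType) (F : I -> fps int) (h : I -> I) :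
  bijective h -> fps_summable F -> (forall i, F (h i) = - F i) ->
  fps_sum F = 0.
Proof.
move=> hbij sF Fh; have H : fps_sum F = - fps_sum F.
  rewrite {1}(fps_sum_reindex _ hbij) -mulN1r -fps_sum_mull //.
  by congr fps_sum; apply/funext => i; rewrite /= Fh mulN1r.
apply/fpsP => n; have Hn : coefps (fps_sum F) n = - coefps (fps_sum F) n.
  by rewrite {1}H.
rewrite -[RHS]/(0 : int); move: (coefps _ n) Hn => c; lia.
Qed.

(** For the image $(i,j)$ of $(r,(k,l))$ one has $i - j = 3l + (r-1)$. The coordinates are chosen so
    that $i^2 + 2j^2$ has no $kl$ term. *)
Definition mod3_split (p : 'I_3 * (int * int)) : int * int :=
  (p.2.1 + 2 * p.2.2 + (p.1%:Z - 1), p.2.1 - p.2.2).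

Lemma mod3_split_bij : bijective mod3_split.
Proof.
exists (fun p => (inord `|((p.1 - p.2 + 1) %% 3)%Z|%N,
    (p.2 + ((p.1 - p.2 + 1) %/ 3)%Z, ((p.1 - p.2 + 1) %/ 3)%Z))).
  move=> [[r r3] [k l]]; rewrite /mod3_split /=.
  congr (_, (_, _)); [apply: val_inj; rewrite /= inordK; lia | lia | lia].
move=> [i j]; rewrite /mod3_split /= inordK; last by lia.
by congr (_, _); lia.
Qed.

(* The product of the two theta series is a double series over (i, j); sorting
   it by i - j mod 3 diagonalises the exponent.  One class cancels, and the two
   others factor through the pentagonal number series. *)
Lemma quintuple_product (x : fps int) (a w : nat) (B : int -> fps int) :
  coefps x 0 = 0 -> (0 < a)%N -> (0 < w)%N -> fps_summable B ->
  (forall k (e : nat),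
     (2 * e)%:Z = 3 * (2 * a%:Z + w%:Z) * k ^+ 2 - (8 * a%:Z + w%:Z) * k
                  + 2 * a%:Z ->
     B k = x ^+ e) ->
  theta (- x ^+ a) (- x ^+ (a + w)) * theta (- x ^+ (4 * a + w)) (- x ^+ w)
  = euler_phi (x ^+ (4 * a + 2 * w))
      * (theta (x ^+ (5 * a + w)) (x ^+ (a + 2 * w)) - fps_sum B).
Proof.
move=> x0 a0 w0 sB BE.
have X0 n : (0 < n)%N -> coefps (x ^+ n) 0 = 0 by exact: coefps0_exp.
have N0 n : (0 < n)%N -> coefps (- x ^+ n) 0 = 0.
  by move=> n0; rewrite /= X0 // oppr0.
have sT b c : (0 < b)%N -> (0 < c)%N ->
    fps_summable (theta_term (- x ^+ b) (- x ^+ c)).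
  by move=> b0 c0; apply: theta_summable; apply: N0.
have sT' b c : (0 < b)%N -> (0 < c)%N ->
    fps_summable (theta_term (x ^+ b) (x ^+ c)).
  by move=> b0 c0; apply: theta_summable; apply: X0.
set q := (4 * a + 2 * w)%N.
set F := theta_term (- x ^+ a) (- x ^+ (a + w)).
set G := theta_term (- x ^+ (4 * a + w)) (- x ^+ w).
have FG i j : exists e : nat,
    (2 * e)%:Z = (2 * a%:Z + w%:Z) * i ^+ 2 + w%:Z * i
               + 2 * (2 * a%:Z + w%:Z) * j ^+ 2 - 4 * a%:Z * j /\
    F i * G j = (-1) ^+ (`|i| + `|j|)%N * x ^+ e.
  have [e [ie Fi]] := theta_term_oppexpP x a (a + w) i.
  have [f [jf Gj]] := theta_term_oppexpP x (4 * a + w) w j.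
  exists (e + f)%N; split; last by rewrite /F /G Fi Gj !exprD; ring.
  by rewrite mulnDr PoszD ie jf !(PoszM, PoszD); ring.
have sF : fps_summable F by apply: sT; lia.
have sG : fps_summable G by apply: sT; lia.
have sFG := fps_summable_mul sF sG.
have inj_r (r : 'I_3) : injective (fun p => mod3_split (r, p)).
  by move=> p p' /(bij_inj mod3_split_bij)[].
transitivity (fps_sum (fun p => F p.1 * G p.2)); first exact: (fps_sum_mul sF sG).
rewrite (fps_sum_partition mod3_split_bij sFG) !big_ord_recl big_ord0 addr0.
(* For $i - j = 3l + 1$ the exponent depends on $l$ only through $l(l+1)$, so $l \mapsto -1-l$
   preserves it, while the parity of $i + j = 2k + l + 1$ changes. *)
have class2 : fps_sum (fun p => F (mod3_split (lift ord0 (lift ord0 ord0), p)).1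
    * G (mod3_split (lift ord0 (lift ord0 ord0), p)).2) = 0.
  apply: (@fps_sum_antisymmetric _ _ (fun p => (p.1, - 1 - p.2))).
  - by exists (fun p => (p.1, - 1 - p.2)); move=> [k l] /=; congr (_, _); ring.
  - exact: fps_summable_inj (@inj_r _) sFG.
  move=> [k l]; rewrite /mod3_split /=.
  have [e [He ->]] := FG (k + 2 * (-1 - l) + (2%:Z - 1)) (k - (-1 - l)).
  have [f [Hf ->]] := FG (k + 2 * l + (2%:Z - 1)) (k - l).
  rewrite -[RHS]mulN1r [RHS]mulrA -exprS; congr (_ * _ ^+ _).
    by apply: signr_eq; lia.
  suff : (2 * e)%:Z = (2 * f)%:Z by lia.
  by rewrite He Hf; ring.
have class1 : fps_sum (fun p => F (mod3_split (lift ord0 ord0, p)).1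
    * G (mod3_split (lift ord0 ord0, p)).2)
    = theta (x ^+ (5 * a + w)) (x ^+ (a + 2 * w)) * euler_phi (x ^+ q).
  rewrite -pentagonal_number; last by apply: X0; lia.
  rewrite -exprM fps_sum_mul; [|by apply: sT'; lia|by apply: sT; lia].
  congr fps_sum; apply/funext => -[k l]; rewrite /mod3_split /=.
  have [e [He ->]] := FG (k + 2 * l + (1%:Z - 1)) (k - l).
  have [f [Hf ->]] := theta_term_oppexpP x q (q * 2) l.
  (* The entry with $l = 0$ gives the part of the exponent in $k$; what remains is $q(3l^2+l)/2$,
     the pentagonal exponent. *)
  have [g [Hg _]] := FG k k.
  have -> : theta_term (x ^+ (5 * a + w)) (x ^+ (a + 2 * w)) k = x ^+ g.
    by apply: theta_term_expE; rewrite Hg !(PoszM, PoszD); ring.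
  rewrite mulrCA -exprD; congr (_ * _ ^+ _).
    by apply: signr_eq; lia.
  suff : (2 * e)%:Z = (2 * g)%:Z + (2 * f)%:Z by lia.
  by rewrite He Hf Hg /q !(PoszM, PoszD); ring.
have class0 : fps_sum (fun p => F (mod3_split (ord0, p)).1
    * G (mod3_split (ord0, p)).2) = - (fps_sum B * euler_phi (x ^+ q)).
  rewrite -pentagonal_number; last by apply: X0; lia.
  have sP : fps_summable (theta_term (- x ^+ (q * 2)) (- x ^+ q)).
    by apply: sT; lia.
  (* The exponent in $l$ is now $q(3l^2-l)/2$, so the pentagonal series is taken with its arguments
     exchanged; the minus sign comes from $i + j = 2k + l - 1$. *)
  rewrite thetaC -exprM (fps_sum_mul sB sP) -[RHS]mulN1r.
  rewrite -(fps_sum_mull _ (fps_summable_mul sB sP)).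
  congr fps_sum; apply/funext => -[k l]; rewrite /mod3_split /=.
  have [e [He ->]] := FG (k + 2 * l + (0%:Z - 1)) (k - l).
  have [f [Hf ->]] := theta_term_oppexpP x (q * 2) q l.
  have [g [Hg _]] := FG (k - 1) k.
  rewrite (BE k g); last by rewrite Hg; ring.
  rewrite [x ^+ g * _]mulrCA [RHS]mulrA -exprS -exprD; congr (_ * _ ^+ _).
    by apply: signr_eq; lia.
  suff : (2 * e)%:Z = (2 * g)%:Z + (2 * f)%:Z by lia.
  by rewrite He Hf Hg /q !(PoszM, PoszD); ring.
by rewrite class0 class1 class2; ring.
Qed.

(** * The product side in base $x^8$ *)

Lemma euler_phi_even (R : comNzRingType) (Q : fps R) : coefps Q 0 = 0 ->
  euler_phi Q = qpoch Q (Q ^+ 2) * euler_phi (Q ^+ 2).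
Proof.
move=> Q0; rewrite !euler_phiE (@qpoch_dissect _ 2 Q Q) // !big_ord_recl.
by rewrite big_ord0 /= expr0 expr1 !mulr1 -expr2.
Qed.

(** After the triple product, each factor in base $x^{16}$ splits as $(y;x^8)_\infty(-y;x^8)_\infty$
    with $y = x^c$ or $x^d$. The factors at $-y$ rebuild [theta (x ^+ c) (x ^+ d)]; the others form
    $(x;x^2)_\infty$, which is $\varphi(x)/\varphi(x^2)$. *)
Lemma theta_opp_product (R : comUnitRingType) (x : fps R) (a b c d : nat) :
  coefps x 0 = 0 -> (0 < a)%N -> (0 < b)%N -> (0 < c)%N -> (0 < d)%N ->
  (a + b = 8)%N -> (c + d = 8)%N ->
  qpoch (x ^+ a) (x ^+ 8) * qpoch (x ^+ b) (x ^+ 8)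
    * (qpoch (x ^+ c) (x ^+ 8) * qpoch (x ^+ d) (x ^+ 8)) = qpoch x (x ^+ 2) ->
  theta (- x ^+ a) (- x ^+ b) * theta (- x ^+ (2 * c)) (- x ^+ (2 * d))
    * euler_phi (x ^+ 2)
  = euler_phi (x ^+ 16) * (theta (x ^+ c) (x ^+ d) * euler_phi x).
Proof.
move=> x0 a0 b0 c0 d0 ab cd.
have X0 n : (0 < n)%N -> coefps (x ^+ n) 0 = 0 by exact: coefps0_exp.
have N0 n : (0 < n)%N -> coefps (- x ^+ n) 0 = 0.
  by move=> n0; rewrite /= X0 // oppr0.
rewrite !jacobi_triple_product ?N0 ?X0 ?muln_gt0 // !mulrNN !opprK -!exprD.
rewrite -mulnDr ab cd.
have sq e : qpoch (x ^+ (2 * e)) (x ^+ 16)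
    = qpoch (x ^+ e) (x ^+ 8) * qpoch (- x ^+ e) (x ^+ 8).
  have x16 : x ^+ 16 = x ^+ 8 ^+ 2 by rewrite -exprM.
  have xe : x ^+ (2 * e) = x ^+ e ^+ 2 by rewrite -exprM mulnC.
  rewrite x16 xe (qpoch_mulN _ (X0 8 isT)); reflexivity.
(* Stated over variables because ring, on the goal itself, compares powers of x
   with different exponents by unfolding them. *)
have alg (E E2 E8 E16 P A A' B B' C D : fps R) :
    A * A' * (B * B') = P -> E = P * E2 ->
    E8 * (A' * A) * (E16 * (B' * D * (B * C))) * E2
      = E16 * (E8 * (D * C) * E).
  by move=> <- ->; ring.
rewrite !sq => odds; exact (alg _ _ _ _ _ _ _ _ _ _ _ odds (euler_phi_even x0)).
Qed.

Lemma qpoch_odd8 (R : comNzRingType) (x : fps R) : coefps x 0 = 0 ->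
  qpoch x (x ^+ 2) = qpoch x (x ^+ 8) * qpoch (x ^+ 3) (x ^+ 8)
    * (qpoch (x ^+ 5) (x ^+ 8) * qpoch (x ^+ 7) (x ^+ 8)).
Proof.
move=> x0; rewrite (@qpoch_dissect _ 4) ?coefps0_exp //.
rewrite !big_ord_recl big_ord0 /= -!exprM -!exprS mulr1 mulrA; reflexivity.
Qed.

Lemma divr_cross (R : comUnitRingType) (e a b c d : R) :
  e \is a GRing.unit -> c \is a GRing.unit -> d \is a GRing.unit ->
  e * (a * d) = e * b * c -> a / c = b / d.
Proof.
move=> ue uc ud; rewrite -mulrA => /(mulrI ue) ab.
by apply: (mulIr uc); rewrite divrK //; apply: (mulIr ud); rewrite ab mulrAC divrK.
Qed.

(** * The two specializations *)

Section Identities.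
Variable x : fps int.
Hypothesis x0 : coefps x 0 = 0.

Let X0 n : (0 < n)%N -> coefps (x ^+ n) 0 = 0.
Proof. exact: coefps0_exp. Qed.

Let sT a b : (0 < a)%N -> (0 < b)%N -> fps_summable (theta_term (x ^+ a) (x ^+ b)).
Proof. by move=> a0 b0; apply: theta_summable; apply: X0. Qed.

Let cross (a b : fps int) :
  euler_phi (x ^+ 16) * (a * euler_phi x)
    = euler_phi (x ^+ 16) * b * euler_phi (x ^+ 2) ->
  a / euler_phi (x ^+ 2) = b / euler_phi x.
Proof.
by apply: divr_cross; apply: euler_phi_unit; [exact: X0|exact: X0|exact: x0].
Qed.

Lemma theta53_identity :
  theta (x ^+ 5) (x ^+ 3) / euler_phi (x ^+ 2)
    = (theta (x ^+ 11) (x ^+ 13) - x * theta (x ^+ 5) (x ^+ 19)) / euler_phi x.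
Proof.
have alg (A B C D P : fps int) : P = A * B * (C * D) -> A * D * (C * B) = P.
  by move=> ->; ring.
have prod := @theta_opp_product _ x 1 7 5 3 x0 isT isT isT isT erefl erefl
  (alg _ _ _ _ _ (qpoch_odd8 x0)).
have sT195 := @sT 19 5 isT isT.
have -> : x * theta (x ^+ 5) (x ^+ 19)
    = fps_sum (fun k => x * theta_term (x ^+ 19) (x ^+ 5) k).
  by rewrite thetaC (fps_sum_mull _ sT195).
have quint := @quintuple_product x 1 6 _ x0 isT isT (fps_summable_mull x sT195).
(* With [a = 1] and [w = 6] the exponent is $12k^2 - 7k + 1 = (3k-1)(4k-1)$, nonzero at integers, so
   a factor [x] can be split off. *)
apply: cross; rewrite -[LHS]prod; congr (_ * _); apply: quint => k [|e] ke.
  by nia.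
rewrite -[LHS]/(x * theta_term (x ^+ 19) (x ^+ 5) k) [RHS]exprS; congr (_ * _).
by apply: theta_term_expE; lia.
Qed.

Lemma theta17_identity :
  theta x (x ^+ 7) / euler_phi (x ^+ 2)
    = (theta (x ^+ 7) (x ^+ 17) - x ^+ 2 * theta x (x ^+ 23)) / euler_phi x.
Proof.
have alg (A B C D P : fps int) : P = A * B * (C * D) -> B * C * (D * A) = P.
  by move=> ->; ring.
have prod := @theta_opp_product _ x 3 5 7 1 x0 isT isT isT isT erefl erefl
  (alg _ _ _ _ _ (qpoch_odd8 x0)).
(* The shift by 1 matches the indexing of [quintuple_product]: the term at $k-1$ has exponent $12k^2
   - 13k + 1$. *)
have sT1 : fps_summable (theta_term (x ^+ 1) (x ^+ 23) \o (fun k => k - 1)).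
  by apply: fps_summable_inj; [exact: addIr | exact: sT].
have shift_bij : bijective (fun k : int => k - 1).
  by exists (fun k => k + 1) => k; ring.
have -> : x ^+ 2 * theta x (x ^+ 23)
    = fps_sum (fun k => x ^+ 2 * theta_term (x ^+ 1) (x ^+ 23) (k - 1)).
  rewrite (fps_sum_mull _ sT1); congr (_ * _).
  exact: (fps_sum_reindex _ shift_bij).
have quint := @quintuple_product x 3 2 _ x0 isT isT
  (fps_summable_mull (x ^+ 2) sT1).
rewrite [theta x _]thetaC [theta (x ^+ 7) (x ^+ 17)]thetaC.
apply: cross; rewrite -[LHS]prod; congr (_ * _).
(* With [a = 3] and [w = 2] the exponent is $12k^2 - 13k + 3$, which is never 0 or 1 at an integer,
   so $x^2$ can be split off. *)
apply: quint => k [|[|e]] ke; [by nia | by nia |].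
rewrite -[LHS]/(x ^+ 2 * theta_term (x ^+ 1) (x ^+ 23) (k - 1)).
by rewrite [RHS](exprD x 2 e); congr (_ * _); apply: theta_term_expE; lia.
Qed.

End Identities.

Theorem lemma5p3 :
  let q : fps int := fpsX int in
  theta (q ^+ 5) (q ^+ 3) / euler_phi (q ^+ 2)
    = (theta (q ^+ 11) (q ^+ 13) - q * theta (q ^+ 5) (q ^+ 19)) / euler_phi q
  /\
  theta q (q ^+ 7) / euler_phi (q ^+ 2)
    = (theta (q ^+ 7) (q ^+ 17) - q ^+ 2 * theta q (q ^+ 23)) / euler_phi q.
Proof. by move=> q; split; [exact: theta53_identity | exact: theta17_identity]. Qed.
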